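(* Let $p>3$ be a prime and let $t\in\mathbb{Z}_p$ with $4t\not\equiv \pm 5\pmod p$. Then $$\sum_{k=0}^{(p-1)/2}\binom{2k}k^2\binom{3k}k\Big(\frac{1-t^2}{108}\Big)^k \equiv \Big(\frac{5-4t}p\Big)\sum_{k=0}^{\lfloor p/6\rfloor}\binom{2k}k\binom{3k}k\binom{6k}{3k} \Big(\frac{(t-1)(t+1)^3}{432(4t-5)^3}\Big)^k \equiv \Big(\frac{5+4t}p\Big)\sum_{k=0}^{\lfloor p/6\rfloor}\binom{2k}k\binom{3k}k\binom{6k}{3k} \Big(\frac{(t+1)(1-t)^3}{432(4t+5)^3}\Big)^k \pmod p.$$
   Context: For a prime $p$, $\mathbb{Z}_p$ denotes the set of rational numbers whose denominator is not divisible by $p$; congruences modulo $p$ are taken in $\mathbb{Z}_p$. For $a\in\mathbb{Z}_p$, $\big(\frac ap\big)$ is the Legendre symbol of $a$ (i.e. of any integer congruent to $a$ modulo $p$). $\lfloor x\rfloor$ is the greatest integer not exceeding $x$. *)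

(* Defs.v *)
From HB Require Import structures.
From mathcomp Require Import all_boot all_order all_algebra.
Set Implicit Arguments. Unset Strict Implicit. Unset Printing Implicit Defensive.
Import Order.TTheory GRing.Theory Num.Theory.
Local Open Scope ring_scope.

(* Z_p is the set of rationals whose reduced denominator is prime to p: the
   localization of int at p inside rat, not the p-adic integers. *)
Definition zploc (p : nat) : pred rat := fun x => ~~ (p%:Z %| denq x)%Z.

(* x = y (mod p) in Z_p, i.e. x - y lies in p Z_p; meant for x, y in Z_p. *)
Definition zpcong (p : nat) (x y : rat) : bool := (x - y) / p%:R \in zploc p.

Definition legendrez (p : nat) (a : int) : int :=
  if (p%:Z %| a)%Z then 0
  else if [exists x : 'I_p, (x%:Z ^+ 2 == a %[mod p%:Z])%Z] then 1
  else -1.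

(* The Legendre symbol of a in Z_p is that of an integer congruent to a; we
   take the representative in {0, ..., p-1}.  If p is prime, there is exactly
   one when a is in Z_p and none otherwise (the value 0 is then junk). *)
Definition legendre (p : nat) (a : rat) : int :=
  if [pick r : 'I_p | zpcong p a (r : nat)%:R] is Some r
  then legendrez p (r : nat)%:Z else 0.

(* Main.v *)
(* Modulo p, both sides are values of polynomials in t of degree < p: by the
   Euler criterion the Legendre symbol is (5 - 4t)^((p-1)/2), and
   (p-1)/2 >= 3 floor(p/6) clears the denominators.  The left side is the
   square of a Legendre polynomial (Clausen), so it is annihilated by a third
   order operator with exponents 0, 0, 0 at t = 1.  The same operator kills the
   twisted sum: it maps each term to a difference which telescopes thanks to the
   first order recurrence of the coefficients.  As j^3 <> 0 mod p for 0 < j < p,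
   a solution of degree < p is determined by its value at t = 1, which is 1 on
   both sides.  The last sum is the middle one at -t. *)
Require Import Defs.
From mathcomp Require Import all_boot all_order all_algebra all_field.
From mathcomp Require Import ring zify.
Import Order.TTheory GRing.Theory Num.Theory.
Local Open Scope ring_scope.

(** * A third order differential operator and its solutions of degree below [p] *)

(* [9 E], where [E] is the symmetric square of the operator
   (1 - t^2) y'' - 2 t y' - (2/9) y; the Legendre polynomial of degree
   floor(p/3) is a solution of the latter modulo p. *)
Definition sqleg_op (R : comNzRingType) (f : {poly R}) : {poly R} :=
  9 * (1 - 'X ^+ 2) ^+ 2 * f^`()^`()^`()
  - 54 * 'X * (1 - 'X ^+ 2) * f^`()^`()
  + (62 * 'X ^+ 2 - 26) * f^`() + 8 * 'X * f.

Lemma sqleg_opD (R : comNzRingType) (f g : {poly R}) :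
  sqleg_op R (f + g) = sqleg_op R f + sqleg_op R g.
Proof. rewrite /sqleg_op !derivD; ring. Qed.

Lemma sqleg_opZ (R : comNzRingType) (c : R) (f : {poly R}) :
  sqleg_op R (c *: f) = c *: sqleg_op R f.
Proof. rewrite /sqleg_op !derivZ -!mul_polyC; ring. Qed.

(** By the quotient rule, [f' / f = r / w] gives [f'' / f = r2 / w^2] and [f''' / f = r3 / w^3];
    multiplying by [w ^+ 3] keeps everything polynomial. *)
Lemma sqleg_op_logderiv (R : comNzRingType) (w r f : {poly R}) :
  w * f^`() = r * f ->
  let r2 := w * r^`() + (r - w^`()) * r in
  let r3 := w ^+ 2 * r^`()^`() + w * (2 * r^`() - w^`()^`()) * r
            + (r - 2 * w^`()) * r2 in
  w ^+ 3 * sqleg_op R f =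
    (9 * (1 - 'X ^+ 2) ^+ 2 * r3 - 54 * 'X * (1 - 'X ^+ 2) * w * r2
     + (62 * 'X ^+ 2 - 26) * w ^+ 2 * r + 8 * 'X * w ^+ 3) * f.
Proof.
move=> h1 r2 r3.
have h2 := congr1 (@deriv R) h1; rewrite !derivM in h2.
have h3 := congr1 (@deriv R) h2; rewrite !derivD !derivM in h3.
have e2 : w * f^`()^`() - (r^`() * f + (r - w^`()) * f^`()) = 0.
  by rewrite -(subrr (w^`() * f^`() + w * f^`()^`())) {2}h2; ring.
have e3 : w * f^`()^`()^`() - (r^`()^`() * f + (2 * r^`() - w^`()^`()) * f^`()
    + (r - 2 * w^`()) * f^`()^`()) = 0.
  rewrite -(subrr (w^`()^`() * f^`() + w^`() * f^`()^`()
    + (w^`() * f^`()^`() + w * f^`()^`()^`()))) {2}h3; ring.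
have e1 : w * f^`() - r * f = 0 by rewrite h1 subrr.
have E2 : w ^+ 2 * f^`()^`() - r2 * f = 0.
  apply: etrans (_ : w * 0 + (r - w^`()) * 0 = 0); last by ring.
  by rewrite -{1}e2 -{1}e1 /r2; ring.
have E3 : w ^+ 3 * f^`()^`()^`() - r3 * f = 0.
  apply: etrans (_ : w ^+ 2 * 0 + w * (2 * r^`() - w^`()^`()) * 0
    + (r - 2 * w^`()) * 0 = 0); last by ring.
  by rewrite -{1}e3 -{1}e1 -{1}E2 /r3; ring.
apply/subr0_eq.
apply: etrans (_ : 9 * (1 - 'X ^+ 2) ^+ 2 * 0 - 54 * 'X * (1 - 'X ^+ 2) * w * 0
   + (62 * 'X ^+ 2 - 26) * w ^+ 2 * 0 = 0); last by ring.
by rewrite -{1}E3 -{1}E2 -{1}e1 /sqleg_op; ring.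
Qed.

(** The relation [d k.+1 * b = d k * c k] cancels the contributions of [T k] and [T k.+1] at [Y k],
    so only the boundary term at [N] survives. In the applications it vanishes because [c N = 0]. *)
Lemma sqleg_op_telescope (R : comNzRingType) (M : {poly R})
    (T Y : nat -> {poly R}) (d c : nat -> R) (N : nat) :
  M * sqleg_op R (T 0) = - (c 0 *: Y 0) ->
  (forall k, (k < N)%N -> exists2 b,
     M * sqleg_op R (T k.+1) = b *: Y k - c k.+1 *: Y k.+1 & d k.+1 * b = d k * c k) ->
  M * sqleg_op R (\sum_(0 <= k < N.+1) d k *: T k) = - ((d N * c N) *: Y N).
Proof.
move=> h0; elim: N => [|N IH] h.
  by rewrite big_nat1 sqleg_opZ -scalerAr h0 scalerN scalerA.
rewrite big_nat_recr //= sqleg_opD mulrDr IH; last by move=> k kN; apply: h; exact: ltnW.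
rewrite sqleg_opZ -scalerAr; have [b -> db] := h N (ltnSn N).
by rewrite scalerBr !scalerA db addrA addNr add0r.
Qed.

(* The exponents of [sqleg_op] at 1 are 0, 0, 0: on [(X - 1) ^+ j] its leading
   coefficient is [36 * j ^+ 3]. *)
Lemma sqleg_op_inj (F : fieldType) (p : nat) (f : {poly F}) :
  p \in [pchar F] -> (3 < p)%N -> (size f <= p)%N ->
  sqleg_op F f = 0 -> f.[1] = 0 -> f = 0.
Proof.
move=> pF p3 szf Ef f1; apply/eqP/negPn/negP => f0.
have [[|i] [g]] := multiplicity_XsubC f 1; rewrite f0 /= => g1 fE.
  by case/negP: g1; apply/eqP; rewrite -f1 fE expr0 mulr1.
have g0 : g != 0 by apply: contraNneq g1 => ->; rewrite root0.
(* The multiplicity [i.+1] of the root 1 is at most the degree of [f], so it is nonzero in [F]. *)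
have jp : (i.+1 < p)%N.
  apply: leq_trans szf; rewrite fE size_Mmonic ?monic_exp ?monicXsubC //.
  by rewrite size_exp_XsubC addnS /= -[i.+2]add1n leq_add2r lt0n size_poly_eq0.
set x := 'X - 1%:P in fE.
have dx : x^`() = 1 by rewrite derivXsubC.
(* [th] is the Euler operator [x d/dx] conjugated by [x ^+ i.+1]; at 1 it multiplies values by
   [i.+1]. *)
pose th h : {poly F} := i.+1%:R * h + x * h^`().
have thE h : x * (h * x ^+ i.+1)^`() = th h * x ^+ i.+1.
  by rewrite derivM deriv_exp dx mul1r /th -mulr_natl exprS /=; ring.
have th1 h : (th h).[1] = i.+1%:R * h.[1].
  by rewrite /th /x !hornerE subrr mul0r addr0 -polyC_natr hornerC.
have h1 : x * f^`() = th g * x ^+ i.+1 by rewrite {1}fE thE.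
have h2 : x * f^`() + x ^+ 2 * f^`()^`() = th (th g) * x ^+ i.+1.
  by rewrite -thE -h1 derivM dx; ring.
have h3 : x * f^`() + 3 * x ^+ 2 * f^`()^`() + x ^+ 3 * f^`()^`()^`()
    = th (th (th g)) * x ^+ i.+1.
  by rewrite -thE -h2 derivD !derivM dx; ring.
(* With [1 - X^2 = - x (X + 1)], the operator times [x] is a combination of powers of [E = x D]:
   [x^2 D^2 = E^2 - E] and [x^3 D^3 = E^3 - 3 E^2 + 2 E]. *)
pose H := 9 * ('X + 1) ^+ 2 * (th (th (th g)) - 3 * th (th g) + 2 * th g)
  + 54 * 'X * ('X + 1) * (th (th g) - th g) + (62 * 'X ^+ 2 - 26) * th g
  + 8 * 'X * x * g.
have HE : H * x ^+ i.+1 = x * sqleg_op F f.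
  apply: etrans (_ : 9 * ('X + 1) ^+ 2 * (th (th (th g)) * x ^+ i.+1
      - 3 * (th (th g) * x ^+ i.+1) + 2 * (th g * x ^+ i.+1))
    + 54 * 'X * ('X + 1) * (th (th g) * x ^+ i.+1 - th g * x ^+ i.+1)
    + (62 * 'X ^+ 2 - 26) * (th g * x ^+ i.+1)
    + 8 * 'X * x * (g * x ^+ i.+1) = _); first by rewrite /H; ring.
  by rewrite -h3 -h2 -h1 -fE /sqleg_op /x polyC1; ring.
have x0 : x != 0 by rewrite polyXsubC_eq0.
move/eqP: HE; rewrite Ef mulr0 mulf_eq0 expf_eq0 (negPf x0) andbF orbF => /eqP.
move/(congr1 (horner^~ 1)); rewrite horner0.
have -> : H.[1] = 36 * i.+1%:R ^+ 3 * g.[1].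
  rewrite /H; move: (th g) (th1 g) => q1 q1E.
  move: (th q1) (th1 q1) => q2 q2E; move: (th q2) (th1 q2) => q3 q3E.
  rewrite !(hornerD, hornerN, hornerM, horner_exp, hornerX, hornerMn, hornerC).
  by rewrite q3E q2E q1E; ring.
apply/eqP; apply: mulf_neq0 g1; apply: mulf_neq0; last first.
  by apply: expf_neq0; rewrite -(dvdn_pcharf pF) gtnNdvd.
rewrite -(dvdn_pcharf pF) (_ : 36 = 2 * 2 * (3 * 3))%N //.
by rewrite !Euclid_dvdM ?(pcharf_prime pF) // !gtnNdvd //; exact: ltnW.
Qed.

(** * Action of the operator on the terms of the two sums *)

(** Explicit polynomials are put in this form to be differentiated, since [ring] does not evaluate
    derivatives. *)
Lemma deriv_cubic (R : comNzRingType) (a b c d : R) :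
  (a%:P + b%:P * 'X + c%:P * 'X ^+ 2 + d%:P * 'X ^+ 3)^`() =
  b%:P + (2 * c)%:P * 'X + (3 * d)%:P * 'X ^+ 2 + 0%:P * 'X ^+ 3.
Proof. rewrite !derivD !mul_polyC !derivZ !derivXn derivC derivX -!mul_polyC; ring. Qed.

(** The logarithmic derivative of [u ^+ k] is [- 2 k X / u]. Only two consecutive powers of [u]
    appear in the result, as telescoping requires. *)
Lemma sqleg_op_geom (R : comNzRingType) (k : nat) (u := 1 - 'X ^+ 2 : {poly R}) :
  u ^+ 3 * sqleg_op R (u ^+ k) =
  - 4 * 'X * (18 * k%:R ^+ 3 - (3 * k + 1)%:R * (2 * k + 1)%:R * (3 * k + 2)%:R * u)
  * u ^+ k.+2.
Proof.
pose r : {poly R} := 0%:P + (- 2 * k%:R)%:P * 'X + 0%:P * 'X ^+ 2 + 0%:P * 'X ^+ 3.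
have uE : u = 1%:P + 0%:P * 'X + (- 1)%:P * 'X ^+ 2 + 0%:P * 'X ^+ 3.
  by rewrite /u; ring.
have hu : u * (u ^+ k)^`() = r * u ^+ k.
  case: k @r => [|k] r; first by rewrite expr0 derivC /r; ring.
  by rewrite deriv_exp /= {2}uE deriv_cubic /r -mulr_natl !exprS; ring.
have du : u^`() = - 2 * 'X by rewrite uE deriv_cubic; ring.
have ddu : u^`()^`() = - 2 by rewrite uE !deriv_cubic; ring.
have dr : r^`() = - 2 * k%:R by rewrite deriv_cubic; ring.
have ddr : r^`()^`() = 0 by rewrite !deriv_cubic; ring.
rewrite (sqleg_op_logderiv _ _ _ _ hu) ddu du ddr dr ![u ^+ _.+1]exprS.
move: (u ^+ k) => v; rewrite /r /u; ring.
Qed.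

(** The hypothesis says [e = - 1/2 - 3 k] in [R], so the term behaves like [q^(-1/2) (P / q^3)^k].
    The factor 2 in the denominator [2 (X^2 - 1) q] of its logarithmic derivative absorbs the one
    half. *)
Lemma sqleg_op_twist (R : comNzRingType) (k e : nat) (q := 5 - 4 * 'X : {poly R})
    (P := - 4 * ('X - 1) * ('X + 1) ^+ 3 : {poly R}) :
  (2 * (3 * k + e) + 1)%:R = 0 :> R ->
  (2 * ('X ^+ 2 - 1) * q) ^+ 3 * sqleg_op R (P ^+ k * q ^+ e) =
  - 8 * (2 * 'X ^+ 2 - 14 * 'X + 11) * ('X ^+ 2 - 1) ^+ 2 *
  (72 * k%:R ^+ 3 * q ^+ 3 - (6 * k + 1)%:R * (2 * k + 1)%:R * (6 * k + 5)%:R * P)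
  * (P ^+ k * q ^+ e).
Proof.
move=> he.
have e2 : 2 * e%:R = - 1 - 6 * k%:R :> {poly R}.
  have E : 2 * e%:R - (- 1 - 6 * k%:R) = (2 * (3 * k + e) + 1)%:R :> {poly R} by ring.
  by apply: subr0_eq; rewrite E -polyC_natr he polyC0.
set w : {poly R} := 2 * ('X ^+ 2 - 1) * q.
pose r : {poly R} := 2 * k%:R * ('X + 1) * q + 6 * k%:R * ('X - 1) * q
  + 4 * (1 + 6 * k%:R) * ('X ^+ 2 - 1).
have wE : w = (- 10)%:P + 8%:P * 'X + 10%:P * 'X ^+ 2 + (- 8)%:P * 'X ^+ 3.
  by rewrite /w /q; ring.
have rE : r = (- 4 - 44 * k%:R)%:P + (56 * k%:R)%:P * 'X
    + (4 - 8 * k%:R)%:P * 'X ^+ 2 + 0%:P * 'X ^+ 3.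
  by rewrite /r /q; ring.
have qE : q = 5%:P + (- 4)%:P * 'X + 0%:P * 'X ^+ 2 + 0%:P * 'X ^+ 3.
  by rewrite /q; ring.
have dw : w^`() = 8 + 20 * 'X - 24 * 'X ^+ 2 by rewrite wE deriv_cubic; ring.
have ddw : w^`()^`() = 20 - 48 * 'X by rewrite wE !deriv_cubic; ring.
have dr : r^`() = 56 * k%:R + 2 * (4 - 8 * k%:R) * 'X by rewrite rE deriv_cubic; ring.
have ddr : r^`()^`() = 2 * (4 - 8 * k%:R) by rewrite rE !deriv_cubic; ring.
have dq : q^`() = - 4 by rewrite qE deriv_cubic; ring.
have dX1 : ('X + 1 : {poly R})^`() = 1 by rewrite derivD derivX derivC addr0.
have dP : P^`() = - 4 * ('X + 1) ^+ 3 - 12 * ('X - 1) * ('X + 1) ^+ 2.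
  rewrite /P derivM deriv_exp dX1 mul1r.
  rewrite !(derivM, derivB, derivX, derivC, derivN, derivMn).
  by rewrite mul0rn oppr0 mul0r add0r ?subr0 ?mulr1 -[_ *+ 3]mulr_natl; ring.
have hP : 2 * ('X ^+ 2 - 1) * q * (P ^+ k)^`() =
    (2 * k%:R * ('X + 1) * q + 6 * k%:R * ('X - 1) * q) * P ^+ k.
  case: k {he e2 r rE dr ddr} => [|k]; first by rewrite expr0 derivC; ring.
  rewrite deriv_exp /= dP -[_ *+ k.+1]mulr_natl [P ^+ k.+1]exprS.
  by move: (P ^+ k) => v; rewrite /P; ring.
have hq : 2 * ('X ^+ 2 - 1) * q * (q ^+ e)^`() =
    4 * (1 + 6 * k%:R) * ('X ^+ 2 - 1) * q ^+ e.
  rewrite (_ : 1 + 6 * k%:R = - (2 * e%:R)); last by rewrite e2; ring.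
  case: e {he e2} => [|e]; first by rewrite expr0 derivC; ring.
  rewrite deriv_exp /= dq -[_ *+ e.+1]mulr_natl [q ^+ e.+1]exprS.
  by move: (q ^+ e) => v; ring.
have hT : w * (P ^+ k * q ^+ e)^`() = r * (P ^+ k * q ^+ e).
  by rewrite derivM mulrDr mulrA hP mulrCA hq /r; ring.
rewrite (sqleg_op_logderiv _ _ _ _ hT) ddw dw ddr dr.
move: (P ^+ k * q ^+ e) => v; rewrite /r /w /q /P; ring.
Qed.

(** The sum telescopes, and the coefficient of the boundary term contains the factor [2 * N + 1],
    which is zero. *)
Lemma sqleg_op_sum_geom (F : fieldType) (a : nat -> F) (N : nat) :
  (forall k, 18 * k.+1%:R ^+ 3 * a k.+1
     = (3 * k + 1)%:R * (2 * k + 1)%:R * (3 * k + 2)%:R * a k) ->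
  (2 * N + 1)%:R = 0 :> F ->
  sqleg_op F (\sum_(0 <= k < N.+1) a k *: (1 - 'X ^+ 2) ^+ k) = 0.
Proof.
move=> ha hN; set u : {poly F} := 1 - 'X ^+ 2.
have u0 : u != 0 by rewrite -oppr_eq0 opprB -polyC1 -size_poly_gt0 size_XnsubC.
apply: (@mulfI _ (u ^+ 3)); first by rewrite expf_neq0.
pose Y k := - 4 * 'X * u ^+ k.+3.
pose c k : F := (3 * k + 1)%:R * (2 * k + 1)%:R * (3 * k + 2)%:R.
rewrite mulr0 (@sqleg_op_telescope _ _ (fun k => u ^+ k) Y a c).
- by rewrite /c hN !(mulr0, mul0r) scale0r oppr0.
- rewrite sqleg_op_geom -/u /Y /c -mul_polyC; ring.
move=> k _; exists (18 * k.+1%:R ^+ 3); last by rewrite mulrC ha mulrC.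
rewrite sqleg_op_geom -/u /Y /c -!mul_polyC ![u ^+ _.+1]exprS; move: (u ^+ k) => v; ring.
Qed.

(** Here the boundary coefficient contains [(6 * n + 1) * (6 * n + 5)]; [3 * n <= K] keeps
    [K - 3 * k] from being truncated. *)
Lemma sqleg_op_sum_twist (F : fieldType) (b : nat -> F) (n K : nat)
    (q := 5 - 4 * 'X : {poly F}) (P := - 4 * ('X - 1) * ('X + 1) ^+ 3 : {poly F}) :
  2%:R != 0 :> F ->
  (forall k, 72 * k.+1%:R ^+ 3 * b k.+1
     = (6 * k + 1)%:R * (2 * k + 1)%:R * (6 * k + 5)%:R * b k) ->
  (2 * K + 1)%:R = 0 :> F -> (3 * n <= K)%N ->
  (6 * n + 1)%:R * (6 * n + 5)%:R = 0 :> F ->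
  sqleg_op F (\sum_(0 <= k < n.+1) b k *: (P ^+ k * q ^+ (K - 3 * k))) = 0.
Proof.
move=> F2 hb hK hnK hn.
set w : {poly F} := 2 * ('X ^+ 2 - 1) * q.
have w0 : w != 0.
  rewrite !mulf_neq0 //.
  - by rewrite -polyC_natr polyC_eq0.
  - by rewrite -polyC1 -size_poly_gt0 size_XnsubC.
  apply: contraNneq (oner_neq0 F) => q0; have := congr1 (horner^~ 1) q0.
  rewrite /q !(hornerD, hornerN, hornerM, hornerX, hornerMn, hornerC) => h.
  by rewrite -h; apply/eqP; ring.
apply: (@mulfI _ (w ^+ 3)); first by rewrite expf_neq0.
pose Z : {poly F} := - 8 * (2 * 'X ^+ 2 - 14 * 'X + 11) * ('X ^+ 2 - 1) ^+ 2.
pose T k := P ^+ k * q ^+ (K - 3 * k).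
pose c k : F := (6 * k + 1)%:R * (2 * k + 1)%:R * (6 * k + 5)%:R.
have Tk k : (k <= n)%N -> w ^+ 3 * sqleg_op F (T k)
    = Z * (72 * k%:R ^+ 3 * q ^+ 3 - (c k)%:P * P) * T k.
  move=> kn; rewrite sqleg_op_twist; last first.
    by rewrite subnKC // (leq_trans _ hnK) // leq_mul2l.
  by rewrite /c !rmorphM /= !polyC_natr.
rewrite mulr0 (@sqleg_op_telescope _ _ T (fun k => Z * P * T k) b c).
- by rewrite /c mulrAC hn mul0r mulr0 scale0r oppr0.
- by rewrite Tk // -mul_polyC; ring.
move=> k kn; exists (72 * k.+1%:R ^+ 3); last by rewrite mulrC hb mulrC.
(* This shift relation turns the [q ^+ 3] part at [k.+1] into the [P] part at [k]. *)
have qT : q ^+ 3 * T k.+1 = P * T k.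
  rewrite /T [P ^+ k.+1]exprS -(mulrA P) !(mulrCA (q ^+ 3)) -exprD.
  by congr (_ * (_ * _ ^+ _)); lia.
rewrite Tk // -!mul_polyC.
have -> : Z * P * T k = Z * (q ^+ 3 * T k.+1) by rewrite qT mulrA.
ring.
Qed.

(** * First order recurrences of the binomial products *)

Lemma fact_bin2 k : ('C(2 * k, k) * k`! ^ 2 = (2 * k)`!)%N.
Proof.
have := @bin_fact (2 * k) k; rewrite (_ : 2 * k - k = k)%N; last by lia.
by rewrite -mulnn; apply; lia.
Qed.

Lemma fact_bin3 k : ('C(3 * k, k) * (k`! * (2 * k)`!) = (3 * k)`!)%N.
Proof.
have := @bin_fact (3 * k) k; rewrite (_ : 3 * k - k = 2 * k)%N; last by lia.
by apply; lia.
Qed.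

Lemma fact_bin6 k : ('C(6 * k, 3 * k) * (3 * k)`! ^ 2 = (6 * k)`!)%N.
Proof. by rewrite (_ : 6 * k = 2 * (3 * k))%N ?fact_bin2 //; lia. Qed.

(** The product equals [(2k)! (3k)! / k!^5]; the ratio of successive terms is computed with
    denominators cleared. *)
Lemma rec_bin23 k :
  (k.+1 ^ 3 * ('C(2 * k.+1, k.+1) ^ 2 * 'C(3 * k.+1, k.+1))
   = 6 * (3 * k + 1) * (2 * k + 1) * (3 * k + 2) * ('C(2 * k, k) ^ 2 * 'C(3 * k, k)))%N.
Proof.
have fE j : ('C(2 * j, j) ^ 2 * 'C(3 * j, j) * j`! ^ 5 = (2 * j)`! * (3 * j)`!)%N.
  by rewrite -[in RHS]fact_bin3 -fact_bin2; ring.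
apply/eqP; rewrite -(eqn_pmul2r (_ : 0 < k.+1 ^ 2 * k`! ^ 5)%N); last first.
  by rewrite muln_gt0 !expn_gt0 fact_gt0.
apply/eqP; transitivity ((2 * k.+1)`! * (3 * k.+1)`!)%N.
  by rewrite -fE factS; ring.
transitivity ((6 * (3 * k + 1) * (2 * k + 1) * (3 * k + 2)) * k.+1 ^ 2 *
   ((2 * k)`! * (3 * k)`!))%N; last by rewrite -fE; ring.
rewrite (_ : 2 * k.+1 = (2 * k).+2)%N; last by lia.
rewrite (_ : 3 * k.+1 = (3 * k).+3)%N; last by lia.
by rewrite !factS; ring.
Qed.

(** The product equals [(6k)! / (k!^3 (3k)!)]. *)
Lemma rec_bin236 k :
  (k.+1 ^ 3 * ('C(2 * k.+1, k.+1) * 'C(3 * k.+1, k.+1) * 'C(6 * k.+1, 3 * k.+1))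
   = 24 * (6 * k + 1) * (2 * k + 1) * (6 * k + 5)
     * ('C(2 * k, k) * 'C(3 * k, k) * 'C(6 * k, 3 * k)))%N.
Proof.
have fE j : ('C(2 * j, j) * 'C(3 * j, j) * 'C(6 * j, 3 * j) * (j`! ^ 3 * (3 * j)`!)
    = (6 * j)`!)%N.
  by rewrite -fact_bin6 -!fact_bin3 -fact_bin2; ring.
apply/eqP; rewrite -(eqn_pmul2r (_ : 0 < k`! ^ 3 * (3 * k.+1)`!)%N); last first.
  by rewrite muln_gt0 expn_gt0 !fact_gt0.
apply/eqP; transitivity (6 * k.+1)`!.
  by rewrite -fE factS; ring.
rewrite (_ : 6 * k.+1 = (6 * k).+3.+3)%N; last by lia.
rewrite (_ : 3 * k.+1 = (3 * k).+3)%N; last by lia.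
by rewrite !factS -fE; ring.
Qed.

(** * Equality of the two sums in characteristic [p] *)

(** A prime above 3 is 1 or 5 modulo 6. The equalities kill the boundary terms of both sums; the
    inequality makes the exponents [K - 3 k] nonnegative. *)
Lemma prime_quotients (p : nat) : prime p -> (3 < p)%N ->
  [/\ 2 * ((p - 1) %/ 2) + 1 = p,
      6 * (p %/ 6) + 1 = p \/ 6 * (p %/ 6) + 5 = p
    & 3 * (p %/ 6) <= (p - 1) %/ 2]%N.
Proof.
move=> pr p3.
have p2 : (p %% 2 != 0)%N by rewrite -/(2 %| p)%N dvdn_prime2 // neq_ltn (ltnW p3).
have np3 : (p %% 3 != 0)%N by rewrite -/(3 %| p)%N dvdn_prime2 // neq_ltn p3.
by clear pr; split; lia.
Qed.

Lemma sum_eq_twisted_sum (F : fieldType) (p : nat) (t : F) :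
  p \in [pchar F] -> (3 < p)%N -> 5 - 4 * t != 0 ->
  \sum_(0 <= k < ((p - 1) %/ 2).+1)
      'C(2 * k, k)%:R ^+ 2 * 'C(3 * k, k)%:R * ((1 - t ^+ 2) / 108) ^+ k
  = (5 - 4 * t) ^+ ((p - 1) %/ 2) *
    \sum_(0 <= k < (p %/ 6).+1)
      'C(2 * k, k)%:R * 'C(3 * k, k)%:R * 'C(6 * k, 3 * k)%:R *
      (((t - 1) * (t + 1) ^+ 3) / (432 * (4 * t - 5) ^+ 3)) ^+ k.
Proof.
move=> pF p3 Q0; have pr := pcharf_prime pF.
have F2 : 2%:R != 0 :> F by rewrite -(dvdn_pcharf pF) gtnNdvd //; exact: ltnW.
have F3 : 3%:R != 0 :> F by rewrite -(dvdn_pcharf pF) gtnNdvd.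
have F108 : 108%:R != 0 :> F.
  by rewrite (_ : 108 = 2 ^ 2 * 3 ^ 3)%N // natrM !natrX mulf_neq0 ?expf_neq0.
have F1728 : 1728%:R != 0 :> F.
  by rewrite (_ : 1728 = 2 ^ 6 * 3 ^ 3)%N // natrM !natrX mulf_neq0 ?expf_neq0.
set K := ((p - 1) %/ 2)%N; set n := (p %/ 6)%N.
have [KE nE nK] := prime_quotients p pr p3; rewrite -/K -/n in KE nE nK.
have hK : (2 * K + 1)%:R = 0 :> F by rewrite KE pcharf0.
have hn : (6 * n + 1)%:R * (6 * n + 5)%:R = 0 :> F.
  by case: nE => ->; rewrite (pcharf0 pF) ?mulr0 ?mul0r.
(* The powers of 108 and of [1728 = 4 * 432] go into the coefficients, the 4 being compensated in
   [P]. The recurrence constants become [6 / 108 = 1 / 18] and [24 / 1728 = 1 / 72]. *)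
pose a k : F := 'C(2 * k, k)%:R ^+ 2 * 'C(3 * k, k)%:R / 108 ^+ k.
pose b k : F := 'C(2 * k, k)%:R * 'C(3 * k, k)%:R * 'C(6 * k, 3 * k)%:R / 1728 ^+ k.
have e108 k : 108 ^+ k != 0 :> F by rewrite expf_neq0.
have e1728 k : 1728 ^+ k != 0 :> F by rewrite expf_neq0.
have ha k : 18 * k.+1%:R ^+ 3 * a k.+1 =
    (3 * k + 1)%:R * (2 * k + 1)%:R * (3 * k + 2)%:R * a k.
  have h := congr1 (fun m => m%:R / (6 * 108 ^+ k) : F) (rec_bin23 k).
  rewrite !(natrM, natrX) in h.
  have F6 : 6%:R != 0 :> F by rewrite (natrM _ 2 3) mulf_neq0.
  apply: etrans (etrans _ h) _; rewrite /a ?[108 ^+ k.+1]exprS; field;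
    by rewrite ?e108 ?F108 ?F6.
have hb k : 72 * k.+1%:R ^+ 3 * b k.+1 =
    (6 * k + 1)%:R * (2 * k + 1)%:R * (6 * k + 5)%:R * b k.
  have h := congr1 (fun m => m%:R / (24 * 1728 ^+ k) : F) (rec_bin236 k).
  rewrite !(natrM, natrX) in h.
  have F24 : 24%:R != 0 :> F by rewrite (natrM _ (2 ^ 3) 3) natrX mulf_neq0 ?expf_neq0.
  apply: etrans (etrans _ h) _; rewrite /b ?[1728 ^+ k.+1]exprS; field;
    by rewrite ?e1728 ?F1728 ?F24.
set q : {poly F} := 5 - 4 * 'X.
set P : {poly F} := - 4 * ('X - 1) * ('X + 1) ^+ 3.
have qx x : q.[x] = 5 - 4 * x.
  by rewrite /q !(hornerD, hornerN, hornerM, hornerX, hornerMn, hornerC).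
have Px x : P.[x] = - 4 * (x - 1) * (x + 1) ^+ 3.
  by rewrite /P !(hornerD, hornerN, hornerM, horner_exp, hornerX, hornerMn, hornerC).
have q1 : q.[1] = 1 by rewrite qx; ring.
have P1 : P.[1] = 0 by rewrite Px; ring.
have sq : (size q <= 2)%N.
  rewrite (_ : q = (- 4) *: 'X + 5%:P); last by rewrite /q -mul_polyC; ring.
  rewrite (leq_trans (size_polyD _ _)) // geq_max.
  rewrite (leq_trans (size_scale_leq _ _)) ?size_polyX //.
  exact: leq_trans (size_polyC_leq1 _) _.
have sP : (size P <= 5)%N.
  rewrite (_ : P = (- 4) *: (('X - 1%:P) * ('X - (- 1)%:P) ^+ 3)); last first.
    by rewrite /P -mul_polyC; ring.
  rewrite (leq_trans (size_scale_leq _ _)) // size_Mmonic ?monic_exp ?monicXsubC //.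
    by rewrite size_XsubC size_exp_XsubC.
  by rewrite polyXsubC_eq0.
pose f : {poly F} := \sum_(0 <= k < K.+1) a k *: (1 - 'X ^+ 2) ^+ k.
(* Multiplication by [q^K] makes [(P / q^3)^k] the polynomial [P^k q^(K - 3k)]. *)
pose g : {poly F} := \sum_(0 <= k < n.+1) b k *: (P ^+ k * q ^+ (K - 3 * k)).
have Ef : sqleg_op F f = 0 by exact: sqleg_op_sum_geom.
have Eg : sqleg_op F g = 0 by exact: sqleg_op_sum_twist.
(* Both [1 - X^2] and [P] vanish at 1, so only the term [k = 0] counts. *)
have f1 : f.[1] = 1.
  rewrite /f big_nat_recl // hornerD hornerZ expr0 hornerC horner_sum big1 => [|k _].
    by rewrite /a muln0 !bin0 !expr0 expr1n divr1 !mulr1 addr0.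
  by rewrite hornerZ horner_exp !hornerE ?expr1n ?mulr1 subrr expr0n mulr0.
have g1 : g.[1] = 1.
  rewrite /g big_nat_recl // hornerD hornerZ hornerM expr0 hornerC horner_sum big1 => [|k _].
    by rewrite horner_exp q1 expr1n /b !muln0 !bin0 !expr0 divr1 !mulr1 addr0.
  by rewrite hornerZ hornerM horner_exp P1 expr0n mul0r mulr0.
have sf : (size f <= p)%N.
  rewrite /f big_mkord; apply: (leq_trans (size_sum _ _ _)); apply/bigmax_leqP => k _.
  apply: (leq_trans (size_scale_leq _ _)); apply: (leq_trans (size_poly_exp_leq _ _)).
  rewrite -opprB size_polyN -polyC1 size_XnsubC //= -KE addn1 ltnS leq_mul2l -ltnS.
  exact: ltn_ord.
(* The degree is at most [4k + (K - 3k) = K + k <= 2K = p - 1]. *)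
have sg : (size g <= p)%N.
  rewrite /g big_mkord; apply: (leq_trans (size_sum _ _ _)); apply/bigmax_leqP => k _.
  apply: (leq_trans (size_scale_leq _ _)).
  apply: (leq_trans (size_polyMleq _ _)).
  have h1 : (size (P ^+ k) <= 4 * k + 1)%N.
    apply: (leq_trans (size_poly_exp_leq _ _)).
    by rewrite addn1 ltnS leq_mul2r -subn1 leq_subLR sP orbT.
  have h2 : (size (q ^+ (K - 3 * k)) <= K - 3 * k + 1)%N.
    apply: (leq_trans (size_poly_exp_leq _ _)).
    by rewrite addn1 ltnS -[leqRHS]mul1n leq_mul2r -subn1 leq_subLR sq orbT.
  have := ltn_ord k; move: (nat_of_ord k) (size _) (size _) h1 h2 => j x y h1 h2.
  by clear -KE nK h1 h2; lia.
have fg : f = g.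
  apply: subr0_eq; apply: (@sqleg_op_inj F p) => //.
  - by rewrite (leq_trans (size_polyD _ _)) // size_polyN geq_max sf.
  - by rewrite -scaleN1r sqleg_opD sqleg_opZ Ef Eg scaler0 addr0.
  - by rewrite hornerD hornerN f1 g1 subrr.
have := congr1 (horner^~ t) fg; rewrite /f /g !horner_sum => fgt.
transitivity (\sum_(0 <= k < K.+1) (a k *: (1 - 'X ^+ 2) ^+ k).[t]).
  apply: eq_bigr => k _; rewrite hornerZ horner_exp !hornerE /a exprMn exprVn; ring.
rewrite {}fgt mulr_sumr; apply: eq_big_nat => k /andP[_ kn].
rewrite hornerZ hornerM !horner_exp Px qx /b.
set Q := 5 - 4 * t in Q0 *.
have kK : (3 * k <= K)%N by apply: leq_trans nK; rewrite leq_mul2l.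
rewrite -[in RHS](subnK kK) exprD exprM.
have F4 : 432%:R != 0 :> F.
  by rewrite (natrM _ (2 ^ 4) (3 ^ 3)) !natrX mulf_neq0 ?expf_neq0.
(* The sign comes from [4 t - 5 = - Q], the 4 from [1728 = 4 * 432]. *)
have -> : (t - 1) * (t + 1) ^+ 3 / (432 * (4 * t - 5) ^+ 3)
    = - 4 * (t - 1) * (t + 1) ^+ 3 / (1728 * Q ^+ 3).
  rewrite (_ : 4 * t - 5 = - Q); last by rewrite /Q; ring.
  by field; rewrite oppr_eq0 Q0 F4 F1728.
set x := - 4 * (t - 1) * (t + 1) ^+ 3.
rewrite (exprMn _ x) exprVn (exprMn _ 1728%:R).
have : (Q ^+ 3) ^+ k != 0 by rewrite !expf_neq0.
move: ((Q ^+ 3) ^+ k) (e1728 k) => z y0 z0.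
by field; rewrite z0 y0.
Qed.

(** * Euler's criterion *)

(** Nonzero squares have [K]-th power 1. A nonsquare with [K]-th power 1 would be, with the squares
    of 1, ..., [K], a root number [K + 1] of [X^K - 1]. *)
Lemma euler_criterion (p K : nat) (x : 'F_p) :
  prime p -> (2 * K + 1 = p)%N -> x != 0 ->
  x ^+ K = if [exists y : 'F_p, y ^+ 2 == x] then 1 else - 1.
Proof.
move=> pr KE x0; have pF := pchar_Fp pr.
have unit_exp (y : 'F_p) : y != 0 -> (y ^+ 2) ^+ K = 1.
  move=> y0; apply: (mulfI y0).
  by rewrite mulr1 -exprM -exprS -addn1 KE; have := expf_card y; rewrite card_Fp.
case: existsP => [[y /eqP yx]|nsq].
  by rewrite -yx unit_exp //; apply: contraNneq x0 => y0; rewrite -yx y0 expr0n.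
have := unit_exp _ x0; rewrite -exprM mulnC exprM => /eqP.
rewrite sqrf_eq1 => /orP[/eqP xK|/eqP //].
pose sq i : 'F_p := i.+1%:R ^+ 2.
have K0 : (0 < K)%N by case: K KE {unit_exp xK} pr => // <-.
have nat0 i : (0 < i < p)%N -> i%:R != 0 :> 'F_p.
  by case/andP=> i0 ip; rewrite -(dvdn_pcharf pF) gtnNdvd.
have pK : ('X^K - 1%:P : {poly 'F_p}) != 0 by rewrite -size_poly_gt0 size_XnsubC.
have /(max_poly_roots pK) : all (root ('X^K - 1%:P)) (x :: map sq (iota 0 K)).
  apply/allP => y; rewrite rootE !hornerE inE => /orP[/eqP ->|/mapP[i]].
    by rewrite xK subrr.
  rewrite mem_iota add0n => /andP[_ iK] ->.
  by rewrite unit_exp ?subrr // nat0 //; lia.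
move=> le_roots; suff /le_roots : uniq (x :: map sq (iota 0 K)).
  by rewrite size_XnsubC //= size_map size_iota ltnn.
rewrite /=; apply/andP; split.
  by apply/mapP => -[i _ xE]; apply: nsq; exists i.+1%:R; rewrite xE.
rewrite map_inj_in_uniq ?iota_uniq // => i j; rewrite !mem_iota !add0n /= => iK jK.
wlog ij : i j iK jK / (i <= j)%N => [hw h|].
  by case/orP: (leq_total i j) => ?; [|apply: esym]; apply: hw.
(* Equal squares force [i + j + 2] or [j - i] to vanish modulo [p]; as [i + j + 2 <= 2 K < p], only
   [i = j] is possible. *)
move/eqP; rewrite eq_sym eqf_sqr => /orP[]; last first.
  by rewrite -addr_eq0 -natrD (negPf (nat0 _ _)) //; lia.
rewrite -subr_eq0 -natrB // subSS; case: (ltngtP i j) ij => // ij _.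
by rewrite (negPf (nat0 _ _)) //; lia.
Qed.

(** * Reduction from [Z_p] to [F_p] *)

(* [a] is the reduction modulo [p] of [x] in [Z_p]. *)
Definition zred (p : nat) (x : rat) (a : 'F_p) : Prop :=
  exists n d : int,
    [/\ d%:~R != 0 :> 'F_p, x = n%:~R / d%:~R & a = n%:~R / d%:~R].

Lemma intr_Fp_eq0 (p : nat) (n : int) : prime p ->
  (n%:~R == 0 :> 'F_p) = (p%:Z %| n)%Z.
Proof.
move=> pr; rewrite dvdzE absz_nat (dvdn_pcharf (pchar_Fp pr)).
by case: n => // n; rewrite NegzE mulrNz oppr_eq0 abszN.
Qed.

Lemma intr_Fp_neq0 (p : nat) (n : int) : n%:~R != 0 :> 'F_p -> n%:~R != 0 :> rat.
Proof. by rewrite intr_eq0; apply: contraNneq => ->. Qed.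

Lemma zred_int (p : nat) (n : int) : zred p n%:~R n%:~R.
Proof. by exists n, 1; rewrite !divr1 oner_neq0. Qed.

Lemma zred_nat (p n : nat) : zred p n%:R n%:R.
Proof. exact: (zred_int p n). Qed.

Lemma zredD (p : nat) (x y : rat) (a b : 'F_p) :
  zred p x a -> zred p y b -> zred p (x + y) (a + b).
Proof.
move=> [n [d [d0 -> ->]]] [m [e [e0 -> ->]]].
exists (n * e + m * d), (d * e); split; first by rewrite intrM mulf_neq0.
- by rewrite addf_div ?(intr_Fp_neq0 _ _ d0) ?(intr_Fp_neq0 _ _ e0) // !(intrM, intrD).
- by rewrite addf_div // !(intrM, intrD).
Qed.

Lemma zredM (p : nat) (x y : rat) (a b : 'F_p) :
  zred p x a -> zred p y b -> zred p (x * y) (a * b).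
Proof.
move=> [n [d [d0 -> ->]]] [m [e [e0 -> ->]]].
by exists (n * m), (d * e); rewrite !intrM !mulf_div mulf_neq0.
Qed.

Lemma zredN (p : nat) (x : rat) (a : 'F_p) : zred p x a -> zred p (- x) (- a).
Proof. by move=> [n [d [d0 -> ->]]]; exists (- n), d; rewrite !mulrNz !mulNr. Qed.

Lemma zredV (p : nat) (x : rat) (a : 'F_p) :
  a != 0 -> zred p x a -> zred p x^-1 a^-1.
Proof.
move=> a0 [n [d [d0 -> aE]]]; exists d, n; rewrite aE !invf_div; split=> //.
by apply: contraNneq a0 => n0; rewrite aE n0 mul0r.
Qed.

Lemma zredX (p : nat) (x : rat) (a : 'F_p) n :
  zred p x a -> zred p (x ^+ n) (a ^+ n).
Proof.
move=> xa; elim: n => [|n IH]; first by rewrite !expr0; exact: (zred_nat p 1).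
by rewrite !exprS; apply: zredM.
Qed.

Lemma zred_sum (p N : nat) (x : nat -> rat) (a : nat -> 'F_p) :
  (forall k, zred p (x k) (a k)) ->
  zred p (\sum_(0 <= k < N) x k) (\sum_(0 <= k < N) a k).
Proof.
move=> xa; elim: N => [|N IH]; first by rewrite !big_geq //; exact: (zred_nat p 0).
by rewrite !big_nat_recr //=; apply: zredD.
Qed.

(** Cross multiplication of two fractions for [x] is an identity of integers, which survives in
    [F_p]. *)
Lemma zred_uniq (p : nat) (x : rat) (a b : 'F_p) :
  zred p x a -> zred p x b -> a = b.
Proof.
move=> [n [d [d0 -> ->]]] [m [e [e0 /eqP + ->]]].
rewrite eqr_div ?(intr_Fp_neq0 _ _ d0) ?(intr_Fp_neq0 _ _ e0) //.
rewrite -!intrM eqr_int => /eqP nm; apply/eqP.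
by rewrite eqr_div // -!intrM nm.
Qed.

(** The reduced denominator divides any denominator [d] of [x], so it is prime to [p] as soon as
    some [d] is. *)
Lemma zred_zploc (p : nat) (x : rat) : prime p ->
  (x \in zploc p) <-> exists a, zred p x a.
Proof.
move=> pr; split=> [xp|[_ [n [d [d0 xE _]]]]].
  exists ((numq x)%:~R / (denq x)%:~R), (numq x), (denq x).
  by rewrite intr_Fp_eq0 // divq_num_den.
rewrite unfold_in /zploc -(intr_Fp_eq0 _ _ pr).
have d0Q := intr_Fp_neq0 _ _ d0.
have : (denq x %| d)%Z.
  rewrite -(Gauss_dvdzl d (_ : coprimez (denq x) (numq x))); last first.
    by rewrite /coprimez /gcdz gcdnC; exact: coprime_num_den.
  apply/dvdzP; exists n; apply/eqP; rewrite -(eqr_int rat) !intrM.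
  by rewrite numqE mulrA [d%:~R * _]mulrC xE divfK.
by case/dvdzP=> m dE; apply: contraNneq d0 => h; rewrite dE intrM h mulr0.
Qed.

(** If [(x - y) / p] reduces to [c], then [x - y] reduces to [p c = 0]; conversely, [p] divides the
    numerator of [x - y] and cancels. *)
Lemma zred_zpcong (p : nat) (x y : rat) (a b : 'F_p) : prime p ->
  zred p x a -> zred p y b -> zpcong p x y = (a == b).
Proof.
move=> pr xa yb; have p0 : p%:R != 0 :> rat by rewrite pnatr_eq0 -lt0n prime_gt0.
have pF0 : p%:R = 0 :> 'F_p by exact: pcharf0 (pchar_Fp pr).
apply/idP/eqP => [/(zred_zploc _ _ pr)[c zc]|ab].
  apply/subr0_eq; apply: (zred_uniq _ _ _ _ (zredD _ _ _ _ _ xa (zredN _ _ _ yb))).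
  by have := zredM _ _ _ _ _ zc (zred_nat p p); rewrite pF0 mulr0 divfK.
have [n [d [d0 xyE]]] := zredD _ _ _ _ _ xa (zredN _ _ _ yb).
rewrite ab subrr => /esym/eqP; rewrite mulf_eq0 invr_eq0 (negPf d0) orbF.
rewrite intr_Fp_eq0 // => /dvdzP[m nE].
apply/zred_zploc => //; exists (m%:~R / d%:~R), m, d; split=> //.
by rewrite xyE nE intrM mulrAC mulfK.
Qed.

Lemma legendre_zred (p K : nat) (x : rat) (a : 'F_p) :
  prime p -> (2 * K + 1 = p)%N -> zred p x a -> a != 0 ->
  (legendre p x)%:~R = a ^+ K :> 'F_p.
Proof.
move=> pr KE xa a0; rewrite /legendre.
case: pickP => [r|/= none]; last first.
  (* The element [a], read as a natural number, is itself a representative, so the default value 0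
     is excluded. *)
  have ap : (a < p)%N by rewrite -[X in (_ < X)%N](card_Fp pr) card_ord.
  have := none (Ordinal ap).
  by rewrite /= (zred_zpcong _ _ _ _ _ pr xa (zred_nat _ _)) natr_Zp eqxx.
rewrite (zred_zpcong _ _ _ _ _ pr xa (zred_nat _ _)) => /eqP ar.
rewrite /legendrez -intr_Fp_eq0 // -pmulrn -ar (negPf a0) (euler_criterion p K) //.
suff -> : [exists x : 'I_p, (x%:Z ^+ 2 == r%:Z %[mod p%:Z])%Z]
    = [exists y : 'F_p, y ^+ 2 == a] by case: ifP.
have sqE (i : nat) : (i%:Z ^+ 2 == r%:Z %[mod p%:Z])%Z = (i%:R ^+ 2 == a).
  by rewrite eqz_mod_dvd -intr_Fp_eq0 // intrB rmorphXn /= subr_eq0 ar.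
apply/existsP/existsP => [[i]|[y ya]]; first by rewrite sqE; exists i%:R.
have yp : (y < p)%N by rewrite -[X in (_ < X)%N](card_Fp pr) card_ord.
by exists (Ordinal yp); rewrite sqE /= natr_Zp.
Qed.

Lemma zredB (p : nat) (x y : rat) (a b : 'F_p) :
  zred p x a -> zred p y b -> zred p (x - y) (a - b).
Proof. by move=> xa yb; apply: zredD xa (zredN _ _ _ yb). Qed.

Lemma zred1 (p : nat) : zred p 1 1.
Proof. exact: (zred_nat p 1). Qed.

(* [fail 1] leaves the argument of the twisted sum to [zred_twist_arg]. *)
Ltac zred_arith :=
  repeat match goal with
  | |- zred _ _%:R _ => exact: zred_nat
  | |- zred _ 1 _ => exact: zred1
  | |- zred _ (_ / (432 * _)) _ => fail 1
  | |- zred _ (_ ^+ _) _ => apply: zredX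
  | |- zred _ (_ ^-1) _ => apply: zredV
  | |- zred _ (_ * _) _ => apply: zredM
  | |- zred _ (- _) _ => apply: zredN
  | |- zred _ (_ + _) _ => apply: zredD
  end.

(** Inversion is compatible with reduction only when the denominator is nonzero modulo [p], which is
    checked here. *)
Lemma zred_twist_arg (p : nat) (t : rat) (tau : 'F_p) :
  432 != 0 :> 'F_p -> 5 - 4 * tau != 0 -> zred p t tau ->
  zred p ((t - 1) * (t + 1) ^+ 3 / (432 * (4 * t - 5) ^+ 3))
    ((tau - 1) * (tau + 1) ^+ 3 / (432 * (4 * tau - 5) ^+ 3)).
Proof.
move=> F432 Q0 tT.
have D0 : 432 * (4 * tau - 5) ^+ 3 != 0.
  by apply: (mulf_neq0 F432); apply: expf_neq0; rewrite -opprB oppr_eq0.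
apply: zredM; last apply: (zredV _ _ _ D0); zred_arith; exact: tT.
Qed.

(** Passing from [t] to [- t] changes the sign of numerator and denominator alike. *)
Lemma twist_argN (F : fieldType) (t : F) :
  (t + 1) * (1 - t) ^+ 3 / (432 * (4 * t + 5) ^+ 3)
  = (- t - 1) * (- t + 1) ^+ 3 / (432 * (4 * - t - 5) ^+ 3).
Proof.
have -> : (- t - 1) * (- t + 1) ^+ 3 = - ((t + 1) * (1 - t) ^+ 3) by ring.
have -> : 432 * (4 * - t - 5) ^+ 3 = - (432 * (4 * t + 5) ^+ 3) by ring.
by rewrite invrN mulrNN.
Qed.

(** * The congruences *)

Theorem theorem2p2 (p : nat) (t : rat)
    (p_prime : prime p) (p_gt3 : (3 < p)%N)
    (t_zp : t \in zploc p)
    (t_neq5 : ~~ zpcong p (4 * t) 5) (t_neqN5 : ~~ zpcong p (4 * t) (- 5)) :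
  let L := \sum_(0 <= k < ((p - 1) %/ 2).+1)
      'C(2 * k, k)%:R ^+ 2 * 'C(3 * k, k)%:R * ((1 - t ^+ 2) / 108) ^+ k in
  let A := (legendre p (5 - 4 * t))%:~R *
    \sum_(0 <= k < (p %/ 6).+1)
      'C(2 * k, k)%:R * 'C(3 * k, k)%:R * 'C(6 * k, 3 * k)%:R *
      (((t - 1) * (t + 1) ^+ 3) / (432 * (4 * t - 5) ^+ 3)) ^+ k in
  let B := (legendre p (5 + 4 * t))%:~R *
    \sum_(0 <= k < (p %/ 6).+1)
      'C(2 * k, k)%:R * 'C(3 * k, k)%:R * 'C(6 * k, 3 * k)%:R *
      (((t + 1) * (1 - t) ^+ 3) / (432 * (4 * t + 5) ^+ 3)) ^+ k in
  zpcong p L A /\ zpcong p A B.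
Proof.
move=> L A B.
have [tau tT] := (zred_zploc _ _ p_prime).1 t_zp.
have pF := pchar_Fp p_prime.
have [KE _ _] := prime_quotients p p_prime p_gt3.
have F2 : 2 != 0 :> 'F_p by rewrite -(dvdn_pcharf pF) gtnNdvd //; exact: ltnW.
have F3 : 3 != 0 :> 'F_p by rewrite -(dvdn_pcharf pF) gtnNdvd.
have F108 : 108 != 0 :> 'F_p.
  by rewrite (_ : 108 = 2 ^ 2 * 3 ^ 3)%N // natrM !natrX mulf_neq0 ?expf_neq0.
have F432 : 432 != 0 :> 'F_p.
  by rewrite (_ : 432 = 2 ^ 4 * 3 ^ 3)%N // natrM !natrX mulf_neq0 ?expf_neq0.
have z4t : zred p (4 * t) (4 * tau) by zred_arith.
have z5 : zred p 5 5 by exact: zred_nat.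
rewrite (zred_zpcong _ _ _ _ _ p_prime z4t z5) in t_neq5.
rewrite (zred_zpcong _ _ _ _ _ p_prime z4t (zredN _ _ _ z5)) in t_neqN5.
have Q1 : 5 - 4 * tau != 0 by rewrite subr_eq0 eq_sym.
have Q2 : 5 - 4 * (- tau) != 0 by rewrite mulrN opprK addrC addr_eq0.
have LE := sum_eq_twisted_sum _ _ _ pF p_gt3 Q1.
have LE' := sum_eq_twisted_sum _ _ _ pF p_gt3 Q2.
have lA := legendre_zred _ _ _ _ p_prime KE (zredB _ _ _ _ _ z5 z4t) Q1.
have lB : (legendre p (5 + 4 * t))%:~R = (5 - 4 * - tau) ^+ ((p - 1) %/ 2) :> 'F_p.
  by apply: legendre_zred; rewrite // mulrN opprK; apply: zredD.
(* The first sum is even in [t], so the identities at [tau] and [- tau] share their left side [S],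
   to which [L], [A] and [B] all reduce. *)
rewrite -lA in LE; rewrite -lB sqrrN in LE'.
set S := \sum_(0 <= k < ((p - 1) %/ 2).+1) _ in LE LE'.
have zL : zred p L S by apply: zred_sum => k; zred_arith => //; exact: tT.
have zA : zred p A S.
  rewrite LE; apply: zredM; first exact: zred_int.
  by apply: zred_sum => k; zred_arith; exact: zred_twist_arg.
have zB : zred p B S.
  rewrite LE'; apply: zredM; first exact: zred_int.
  apply: zred_sum => k; rewrite twist_argN; zred_arith.
  by apply: zred_twist_arg => //; exact: zredN.
rewrite (zred_zpcong _ _ _ _ _ p_prime zL zA).
by rewrite (zred_zpcong _ _ _ _ _ p_prime zA zB) eqxx.
Qed.
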